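(* Let $(M,g)$ be a Riemannian manifold (possibly infinite-dimensional), and let $f:M\to\mathbb{R}$ be a Borel function such that $D^{-}f(p)\cup D^{+}f(p)\neq\emptyset$ for every $p\in M$. Define $\Phi:M\to\mathbb{R}$ by $$\Phi(p)=\inf\{\|\zeta\|_{p} : \zeta\in D^{-}f(p)\cup D^{+}f(p)\}.$$ Then, for every path $\gamma:I\to M$ parameterized by arc length, one has that $$\mu\big(f(\gamma(I))\big)\leq\int_{I}\Phi(\gamma(t))\,dt,$$ where $\mu$ is the Lebesgue measure in $\mathbb{R}$.
   Context: A Riemannian manifold is a $C^\infty$ manifold modelled on a Hilbert space (possibly infinite-dimensional) with a $C^\infty$ assignment of scalar products on the tangent spaces $TM_p$ inducing equivalent norms $\|\cdot\|_p$. $D^{-}f(p)$ (resp. $D^{+}f(p)$) is the set of all $d\varphi(p)\in T^*M_p$ with $\varphi\in C^1(M,\mathbb{R})$ such that $f-\varphi$ attains a local minimum (resp. local maximum) at $p$, and $\|\zeta\|_p=\sup\{|\zeta(h)|:h\in TM_p,\|h\|_p=1\}$. Paths are piecewise $C^1$; a path $\gamma:I=[0,T]\to M$ is parameterized by arc length if $\|\gamma'(t)\|_{\gamma(t)}=1$ for all $t$ (where $\gamma'$ exists). *)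

(* Defs.v *)
From HB Require Import structures.
From mathcomp Require Import all_boot all_order all_algebra.
From mathcomp Require Import all_classical all_reals all_analysis.

Set Implicit Arguments.
Unset Strict Implicit.
Unset Printing Implicit Defensive.

Import Order.TTheory GRing.Theory Num.Theory.
Import numFieldNormedType.Exports.

Local Open Scope classical_set_scope.
Local Open Scope ring_scope.

Section BoundedOperators.
Context {R : realType} {E F : normedModType R}.

Definition bounded_op : {pred E -> F} :=
  fun f => `[< linear f /\ exists C : R, forall x, `|f x| <= C * `|x| >].

Lemma bounded_op_closed : submod_closed bounded_op.
Proof.
split=> [|a f g /asboolP[lf [Cf hf]] /asboolP[lg [Cg hg]]]; apply/asboolP.
  split=> [b x y|]; first by rewrite scaler0 addr0.
  by exists 0 => x; rewrite normr0 mul0r.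
split=> [b x y|].
  rewrite !fctE lf lg !scalerDr !scalerA (mulrC a b) -!addrA.
  by congr (_ + _); rewrite addrCA.
exists (`|a| * Cf + Cg) => x; rewrite !fctE.
apply: le_trans (ler_normD _ _) _; rewrite mulrDl lerD//.
by rewrite normrZ -mulrA ler_wpM2l.
Qed.

End BoundedOperators.

HB.instance Definition _ (R : realType) (E F : normedModType R) :=
  GRing.isSubmodClosed.Build R (E -> F) (@bounded_op R E F)
    (GRing.submod_closed_semi bounded_op_closed).

Record bop (R : realType) (E F : normedModType R) :=
  Bop { bop_fun :> E -> F; _ : bounded_op bop_fun }.

Section BopNormed.
Context {R : realType} {E F : normedModType R}.

HB.instance Definition _ := [isSub of @bop R E F for @bop_fun R E F].
HB.instance Definition _ := [Choice of @bop R E F by <:].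
HB.instance Definition _ := [SubChoice_isSubLmodule of @bop R E F by <:].

Definition opnorm (f : bop E F) : R :=
  sup [set `|f x| | x in [set x : E | `|x| <= 1]].

Lemma bop_linear (f : bop E F) : linear f.
Proof. by case: f => f /= /asboolP[]. Qed.

Lemma bopZ (f : bop E F) (a : R) (x : E) : f (a *: x) = a *: f x.
Proof.
have l := bop_linear f; have f0 : f 0 = 0.
  by have /(congr1 (fun y => y - f 0)) := l 1 0 0; rewrite !scale1r addr0 addrK subrr.
by have := l a x 0; rewrite !addr0 f0 addr0.
Qed.

Lemma opnorm_has_sup (f : bop E F) :
  has_sup [set `|f x| | x in [set x : E | `|x| <= 1]].
Proof.
split; first by exists `|f 0|, 0 => //=; rewrite normr0.
case: f => f /= /asboolP[_ [C hC]]; exists `|C| => _ [x /= x1 <-].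
rewrite (le_trans (hC x))// (le_trans (ler_norm _))// normrM normr_id.
by rewrite ler_piMr.
Qed.

Lemma opnorm_ub (f : bop E F) (x : E) : `|x| <= 1 -> `|f x| <= opnorm f.
Proof.
by move=> x1; apply: sup_upper_bound (opnorm_has_sup f) _ _; exists x.
Qed.

Lemma opnorm_le (f : bop E F) (C : R) :
  (forall x, `|x| <= 1 -> `|f x| <= C) -> opnorm f <= C.
Proof.
move=> h; apply: ge_sup => [|_ [x /= x1 <-]]; last exact: h.
by case: (opnorm_has_sup f).
Qed.

Lemma opnormD (f g : bop E F) : opnorm (f + g) <= opnorm f + opnorm g.
Proof.
apply: opnorm_le => x x1; apply: le_trans (ler_normD (f x) (g x)) _.
by rewrite lerD ?opnorm_ub.
Qed.

Lemma opnormZ (a : R) (f : bop E F) : opnorm (a *: f) = `|a| * opnorm f.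
Proof.
have le b (h : bop E F) : opnorm (b *: h) <= `|b| * opnorm h.
  apply: opnorm_le => x x1; change (`|b *: h x| <= `|b| * opnorm h).
  by rewrite normrZ ler_wpM2l// opnorm_ub.
apply/eqP; rewrite eq_le le/=.
have [->|a0] := eqVneq a 0.
  rewrite normr0 mul0r; apply: le_trans (opnorm_ub (0 *: f) (x := 0) _) => //.
  by rewrite normr0.
have := le a^-1 (a *: f); rewrite scalerA mulVf// scale1r normfV.
by rewrite ler_pdivlMl ?normr_gt0.
Qed.

Lemma opnorm_eq0 (f : bop E F) : opnorm f = 0 -> f = 0.
Proof.
move=> f0; apply: val_inj; apply/funext => x; change (f x = 0).
have [->|x0] := eqVneq x 0; first by rewrite -(scale0r (0 : E)) bopZ scale0r.
have := opnorm_ub f (x := `|x|^-1 *: x).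
rewrite normrZ normfV normr_id mulVf ?normr_eq0// f0 => /(_ (lexx _)).
rewrite normr_le0 bopZ scaler_eq0 invr_eq0 normr_eq0 (negPf x0)/=.
by move/eqP.
Qed.

HB.instance Definition _ :=
  Lmodule_isNormed.Build R (bop E F) opnormD opnormZ opnorm_eq0.

End BopNormed.

(* [U] is meant to be open; [f] is constrained on [U] only. *)
Fixpoint Ck {R : realType} {E : normedModType R} (k : nat)
    {F : normedModType R} (U : set E) (f : E -> F) {struct k} : Prop :=
  if k is k'.+1 then
    (forall x, U x -> differentiable f x) /\
    exists Df : E -> bop E F,
      (forall x, U x -> forall h, Df x h = 'd f x h) /\ Ck k' U Df
  else forall x, U x -> {for x, continuous f}.

Definition Cinf {R : realType} {E F : normedModType R} (U : set E)
  (f : E -> F) : Prop := forall k, Ck k U f.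

(* The charts [chart i : chart_dom i -> E] and their inverses are encoded as
   total functions, irrelevant outside [chart_dom i], resp. its image. *)
Record manifold (R : realType) (E : normedModType R) (M : topologicalType) :=
  Manifold {
  chart_index : Type;
  chart_dom : chart_index -> set M;
  chart : chart_index -> M -> E;
  chart_inv : chart_index -> E -> M;
  manifold_hausdorff : hausdorff_space M;
  chart_dom_open : forall i, open (chart_dom i);
  chart_cover : forall p, exists i, chart_dom i p;
  chart_im_open : forall i, open (chart i @` chart_dom i);
  chartK : forall i p, chart_dom i p -> chart_inv i (chart i p) = p;
  chart_continuous : forall i p, chart_dom i p -> {for p, continuous (chart i)};
  chart_inv_continuous : forall i x, (chart i @` chart_dom i) x ->
    {for x, continuous (chart_inv i)};
  chart_smooth : forall i j,
    Cinf (chart i @` (chart_dom i `&` chart_dom j))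
      (chart j \o chart_inv i) }.

Section TangentSpace.
Context {R : realType} {E : normedModType R} {M : topologicalType}.
Variables (A : manifold E M) (p : M).

(* A tangent vector at [p] is the family of its representatives in the charts
   around [p], related by the differentials of the transition maps; the
   components in the charts not containing [p] are set to 0. *)
Definition tangent_family : {pred chart_index A -> E} := fun v =>
  `[< (forall i, ~ chart_dom i p -> v i = 0) /\
      (forall i j, chart_dom i p -> chart_dom j p ->
         v j = 'd (chart j \o chart_inv i) (chart i p) (v i)) >].

Lemma tangent_family_closed : submod_closed tangent_family.
Proof.
split=> [|a u v /asboolP[u0 uJ] /asboolP[v0 vJ]]; apply/asboolP.
  by split=> // i j _ _; rewrite !fctE linear0.
split=> [i ip|i j ip jp]; rewrite !fctE; first by rewrite u0// v0// scaler0 addr0.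
by rewrite linearP (uJ i j)// (vJ i j).
Qed.

HB.instance Definition _ :=
  GRing.isSubmodClosed.Build R (chart_index A -> E) tangent_family
    (GRing.submod_closed_semi tangent_family_closed).

Record tangent := Tangent {
  tan_coord :> chart_index A -> E; _ : tangent_family tan_coord }.

HB.instance Definition _ := [isSub of tangent for tan_coord].
HB.instance Definition _ := [Choice of tangent by <:].
HB.instance Definition _ := [SubChoice_isSubLmodule of tangent by <:].

End TangentSpace.

Record riemannian (R : realType) (E : normedModType R) (M : topologicalType) :=
  Riemannian {
  riem_atlas :> manifold E M;
  metric : forall p : M, {dot (tangent riem_atlas p) for idfun};
  metric_equiv : forall (p : M) (i : chart_index riem_atlas), chart_dom i p ->
    exists c C : R, [/\ 0 < c, 0 < C &
      forall v : tangent riem_atlas p,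
        c * `|v i| <= Num.sqrt (metric p v v) <= C * `|v i|];
  metric_smooth : forall i : chart_index riem_atlas,
    exists G : E -> bop E (bop E R^o),
      Cinf (chart i @` chart_dom i) G /\
      forall p, chart_dom i p -> forall v w : tangent riem_atlas p,
        metric p v w = G (chart i p) (v i) (w i) }.
Arguments metric {R E M} r p.

Section SubDifferentials.
Context {R : realType} {E : normedModType R} {M : topologicalType}.
Variable g : riemannian E M.

Definition tnorm (p : M) (v : tangent g p) : R := Num.sqrt (metric g p v v).

Definition C1_fun (phi : M -> R) : Prop :=
  forall i : chart_index g,
    Ck 1 (chart i @` chart_dom i) (phi \o chart_inv i : E -> R^o).

Definition is_differential (phi : M -> R) (p : M) (zeta : tangent g p -> R) :=
  forall i : chart_index g, chart_dom i p -> forall v : tangent g p,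
    zeta v = 'd (phi \o chart_inv i : E -> R^o) (chart i p) (v i).

Definition subdiff (f : M -> R) (p : M) : set (tangent g p -> R) :=
  [set zeta | exists phi : M -> R, [/\ C1_fun phi,
    (\forall q \near p, f p - phi p <= f q - phi q) &
    is_differential phi zeta]].

Definition superdiff (f : M -> R) (p : M) : set (tangent g p -> R) :=
  [set zeta | exists phi : M -> R, [/\ C1_fun phi,
    (\forall q \near p, f q - phi q <= f p - phi p) &
    is_differential phi zeta]].

#[local] Arguments subdiff f p _ : clear implicits.
#[local] Arguments superdiff f p _ : clear implicits.

Definition conorm (p : M) (zeta : tangent g p -> R) : R :=
  sup [set `|zeta h| | h in [set h : tangent g p | tnorm h = 1]].

Definition Phi (f : M -> R) (p : M) : R :=
  inf [set conorm zeta | zeta in subdiff f p `|` superdiff f p].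

(* Derivative of [gamma] at [t] relative to [A], hence one-sided at an endpoint
   of [A]; meant for [gamma] continuous on [A]. *)
Definition is_velocity (A : set R) (gamma : R -> M) (t : R)
    (w : tangent g (gamma t)) : Prop :=
  forall i : chart_index g, chart_dom i (gamma t) ->
    (fun s => (s - t)^-1 *: (chart i (gamma s) - chart i (gamma t)))
      @ within A t^' --> w i.

#[local] Arguments is_velocity A gamma t w : clear implicits.

Definition C1_segment (a b : R) (gamma : R -> M) : Prop :=
  exists w : forall t, tangent g (gamma t), forall t, t \in `[a, b] ->
    is_velocity `[a, b] gamma t (w t) /\
    forall i : chart_index g, chart_dom i (gamma t) ->
      (fun s => w s i) @ within `[a, b] (nbhs t) --> w t i.

Definition is_path (T : R) (gamma : R -> M) : Prop :=
  {within `[0, T], continuous gamma} /\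
  exists s : seq R, itv_partition 0 T s /\
    forall k, (k < size s)%N ->
      C1_segment (nth 0 (0 :: s) k) (nth 0 (0 :: s) k.+1) gamma.

Definition arc_length_param (T : R) (gamma : R -> M) : Prop :=
  forall t, t \in `[0, T] -> forall w : tangent g (gamma t),
    is_velocity `[0, T] gamma t w -> tnorm w = 1.

End SubDifferentials.
Arguments is_velocity {R E M} g A gamma t w.
Arguments subdiff {R E M} g f p _.
Arguments superdiff {R E M} g f p _.
Arguments Phi {R E M} g f p.
Arguments is_path {R E M} g T gamma.
Arguments arc_length_param {R E M} g T gamma.

Definition borel_fun {R : realType} {M : topologicalType} (f : M -> R) : Prop :=
  forall B : set R, measurable B -> <<s @open M >> (f @^-1` B).

(* Main.v *)
Require Import Defs.
From HB Require Import structures.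
From mathcomp Require Import all_boot all_order all_algebra.
From mathcomp Require Import all_classical all_reals all_analysis.
From mathcomp Require Import measurable_realfun lra.

Import Order.TTheory GRing.Theory Num.Theory.
Import numFieldNormedType.Exports.

Set Implicit Arguments.
Unset Strict Implicit.
Unset Printing Implicit Defensive.

Local Open Scope classical_set_scope.
Local Open Scope ring_scope.

(** Everything reduces to the real function [h = f \o gamma] on [[0, T]].

    Let [t] be a time where [gamma] has a unit velocity [w], and let
    [Phi (gamma t) < a]. Some sub- or superdifferential [zeta] of [f] at
    [gamma t] has [|zeta w| <= conorm zeta < a], and the test function [phi]
    that produces it satisfies [|phi (gamma s) - phi (gamma t)| <= a |s - t|]
    for [s] near [t] by the chain rule. Since [phi] touches [f] from one side at
    [gamma t], the graph of [h] stays, near [t], on one side of a cone of slope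
    [a] with vertex at [(t, h t)]: above it for a subdifferential, below it for
    a superdifferential (lemma [Phi_lt_calm]).

    The sets where such a cone condition holds on a fixed interval have two
    decisive properties. First, [h] is [a]-Lipschitz on each of them, although
    the condition at a point is only one-sided: the conditions at two points
    bound the increment between them from both sides
    (lemma [above_cone_lipschitz]). Hence [h] multiplies the outer measure of
    any part of such a set by at most [a]. Second, they are Borel when [h] is (lemma [measurable_above_cone]), because
    the infimum of the cones with vertices on the graph of [h] is upper
    semicontinuous.

    Countably many of these sets, with rational intervals, cover the times at
    which [Phi (gamma t) < a], up to finitely many corners. For a small [d > 0],
    let [C k] be the set of times that satisfy a cone condition of slope
    [(k + 1) d] but none of slope [j d] for [0 < j <= k]. On [C k] the function [Phi \o gamma] is at least [k d],
    while the image of [C k] has measure at most [(k + 1) d] times that of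
    [C k]. Summing over [k] gives the inequality up to [d T]
    (lemma [lebesgue_measure_image_le_integral]).

    Both sides of the inequality make sense although [Phi \o gamma] and the image
    of [h] may fail to be measurable. The integral of a nonnegative function is
    the supremum of the integrals of the simple functions below it, so it
    dominates the integral of the step function equal to [k d] on [C k]; and
    [lebesgue_measure] is, on arbitrary sets, the outer measure given by covers
    with half-open intervals, so it is countably subadditive. *)

(** * Outer Lebesgue measure of images *)

Section LebesgueOuter.
Context {R : realType}.
Notation mu := (@lebesgue_measure R).

Lemma lebesgue_measure_subset (A B : set R) :
  A `<=` B -> (mu A <= mu B)%E.
Proof. exact: (le_mu_ext (wlength idfun)). Qed.

Lemma lebesgue_measure_bigcup_le (F : nat -> set R) :
  (mu (\bigcup_n F n) <= \sum_(n <oo) mu (F n))%E.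
Proof. exact: (mu_ext_sigma_subadditive (wlength_ge0 idfun)). Qed.

Lemma lebesgue_measureU_le (A B : set R) :
  (mu (A `|` B) <= mu A + mu B)%E.
Proof. exact: (outer_measureU2 ((wlength idfun)^*)%mu). Qed.

Lemma lebesgue_measure_le_diam (Y : set R) (L : R) : 0 <= L ->
  (forall y z, Y y -> Y z -> y - z <= L) -> (mu Y <= L%:E)%E.
Proof.
move=> L0 YL; have [->|/set0P Y0] := eqVneq Y set0.
  by rewrite measure0 lee_fin.
have [y0 Yy0] := Y0.
have lbY : has_lbound Y.
  by exists (y0 - L) => z Yz; rewrite lerBlDr -lerBlDl; exact: YL.
have : Y `<=` `[inf Y, inf Y + L].
  move=> y Yy /=; rewrite in_itv/= ge_inf//= -lerBlDr.
  by apply: lb_le_inf => // z Yz; rewrite lerBlDr -lerBlDl; exact: YL.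
move/lebesgue_measure_subset/le_trans; apply.
rewrite lebesgue_measure_itv/= lte_fin ltrDl.
by case: ifPn => _; rewrite lee_fin; lra.
Qed.

(** Transport a cover of [S] by half-open intervals: the image of each trace of
    [S] has diameter at most [a] times the length of the interval. *)
Lemma lebesgue_measure_lipschitz_image (h : R -> R) (a : R) (S : set R) :
  0 < a -> (forall x y, S x -> S y -> h x - h y <= a * `|x - y|) ->
  (mu (h @` S) <= a%:E * mu S)%E.
Proof.
move=> a0 hS; rewrite -lee_pdivrMl//; apply: le_ereal_inf_tmp => _ [F [mF SF] <-].
rewrite lee_pdivrMl// -nneseriesZl; last by move=> i _; exact: wlength_ge0.
apply: (@le_trans _ _ (mu (\bigcup_n (h @` (S `&` F n))))).
  apply: lebesgue_measure_subset => _ [x Sx <-].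
  by have [n _ Fnx] := SF x Sx; exists n => //; exists x.
apply: (le_trans (lebesgue_measure_bigcup_le _)).
apply: lee_nneseries => [i _ _|n _]; first exact: measure_ge0.
have /ocitvP[->|[[u v]/= uv ->]] := mF n.
  by rewrite setI0 image_set0 !measure0 mule0.
rewrite (wlength_itv_bnd _ _ _ (ltW uv)) -EFinM; apply: lebesgue_measure_le_diam.
  by rewrite mulr_ge0 ?subr_ge0 ?(ltW uv) ?(ltW a0).
move=> _ _ [x [Sx +] <-] [y [Sy +] <-]; rewrite /= !in_itv/=.
move=> /andP[ux xv] /andP[uy yv].
apply: (le_trans (hS _ _ Sx Sy)); rewrite ler_pM2l// ler_norml; lra.
Qed.

(** Outer measure is not additive, so the bound passes from the pieces to their
    union only because the pieces are measurable and can be made disjoint; this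
    is why the local hypothesis is about all measurable parts of a piece. *)
Lemma lebesgue_measure_image_bigcup (I : countType) (h : R -> R) (a : R)
    (A : I -> set R) (S : set R) : 0 <= a ->
  (forall i, measurable (A i)) -> measurable S -> S `<=` \bigcup_i A i ->
  (forall i S', measurable S' -> S' `<=` A i ->
    (mu (h @` S') <= a%:E * mu S')%E) ->
  (mu (h @` S) <= a%:E * mu S)%E.
Proof.
move=> a0 mA mS SA hA.
pose B n := S `&` (if unpickle n is Some i then A i else set0).
have mB n : measurable (B n).
  by rewrite /B; case: unpickle => [i|]; exact: measurableI.
have SB : S = \bigcup_n seqDU B n.
  rewrite -seqDU_bigcup_eq; apply/seteqP; split => [x Sx|x [n _ []//]].
  have [i _ Aix] := SA x Sx.
  by exists (pickle i) => //; rewrite /B pickleK.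
rewrite {1}SB image_bigcup; apply: (le_trans (lebesgue_measure_bigcup_le _)).
have -> : (mu S = \sum_(n <oo) mu (seqDU B n))%E.
  rewrite [in LHS]SB measure_semi_bigcup//; first exact: seqDU_measurable.
  by rewrite -SB.
rewrite -nneseriesZl//.
apply: lee_nneseries => [i _ _|n _]; first exact: measure_ge0.
have mBn := seqDU_measurable mB n.
have := @subset_seqDU _ B n; rewrite [X in _ `<=` X]/B.
case: unpickle => [i|] BA.
  by apply: (hA i _ mBn); apply: subset_trans BA (@subIsetr _ _ _).
have -> : seqDU B n = set0 by move: BA; rewrite setI0 subset0.
by rewrite image_set0 measure0 mule0.
Qed.

End LebesgueOuter.

(** * Points where a graph stays on one side of a cone *)

Section AboveCone.
Context {R : realType}.
Notation mu := (@lebesgue_measure R).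
Implicit Types (h : R -> R) (a : R) (J : set R).

Definition above_cone h a J :=
  [set t | J t /\ forall s, J s -> h t <= h s + a * `|s - t|].

(** The points [t] of [J] that fail are those with [inf_s (h s + a |s - t|) < h t].
    The infimum over [J] of these continuous functions of [t] is upper
    semicontinuous, and a rational number fits between both sides. *)
Lemma measurable_above_cone h a J : measurable J -> measurable_fun J h ->
  measurable (above_cone h a J).
Proof.
move=> mJ mh.
pose V q := [set t | exists2 s, J s & h s + a * `|s - t| < q].
have oV q : open (V q).
  rewrite (_ : V q = \bigcup_(s in J)
      (fun t => h s + a * `|s - t|) @^-1` [set x | x < q]); last first.
    by apply/seteqP; split=> [t [s Js hs]|t [s Js hs]]; exists s.
  apply: bigcup_open => s _; apply: open_comp; last exact: open_lt.
  move=> t _; apply: cvgD; first exact: cvg_cst.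
  apply: cvgM; first exact: cvg_cst.
  by apply: cvg_norm; apply: cvgB; [exact: cvg_cst|exact: cvg_id].
rewrite (_ : above_cone h a J = J `\` \bigcup_(q : rat)
    (V (ratr q) `&` (J `&` h @^-1` [set x | ratr q < x]))); last first.
  apply/seteqP; split=> [t [Jt ht]|t [Jt nVt]]; split=> //.
    move=> [q _ [[s Js hs] [_ /=]]]; apply/negP; rewrite -leNgt.
    by rewrite (le_trans (ht s Js))// ltW.
  move=> s Js; rewrite leNgt; apply/negP => /rat_in_itvoo[q].
  rewrite in_itv/= => /andP[sq qt]; apply: nVt; exists q => //.
  by split; first by exists s.
apply: measurableD => //; apply: bigcupT_measurable_rat => q.
apply: measurableI; first exact: open_measurable.
by apply: mh => //; apply: open_measurable; exact: open_gt.
Qed.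

(** Exchanging [x] and [y] gives the two-sided Lipschitz bound. *)
Lemma above_cone_lipschitz h a J x y :
  above_cone h a J x -> above_cone h a J y -> h x - h y <= a * `|x - y|.
Proof. by move=> [Jx hx] [Jy _]; rewrite distrC lerBlDl; exact: hx. Qed.

Definition calm_at h a J t :=
  (\forall s \near t, J s -> h t <= h s + a * `|s - t|) \/
  (\forall s \near t, J s -> h s <= h t + a * `|s - t|).

(** The Boolean says on which side the cone lies; rational endpoints make the
    family countable. *)
Definition cone_piece h a J (i : (rat * rat) * bool) :=
  above_cone (if i.2 then h else \- h) a (J `&` `]ratr i.1.1, ratr i.1.2[).

Lemma measurable_cone_piece h a J i : measurable J -> measurable_fun J h ->
  measurable (cone_piece h a J i).
Proof.
move=> mJ mh; apply: measurable_above_cone; first exact: measurableI.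
apply: (measurable_funS mJ); first exact: subIsetl.
by case: i.2 => //; exact: measurableT_comp.
Qed.

Lemma cone_piece_lipschitz h a J i x y :
  cone_piece h a J i x -> cone_piece h a J i y -> h x - h y <= a * `|x - y|.
Proof.
rewrite /cone_piece; case: i.2 => cx cy; first exact: above_cone_lipschitz cx cy.
by have := above_cone_lipschitz cy cx; rewrite distrC opprK addrC.
Qed.

Lemma calm_at_cone_piece h a J t : J t -> calm_at h a J t ->
  exists i, cone_piece h a J i t.
Proof.
move=> Jt ht.
have [b /nbhs_ballP[e /= e0 te]] : exists b, \forall s \near t, J s ->
    (if b then h else \- h) t <= (if b then h else \- h) s + a * `|s - t|.
  case: ht => ht; [exists true|exists false]; first exact: ht.
  apply: filterS ht => s hs Js; move: (hs Js) => /=; lra.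
have /rat_in_itvoo[p] : t - e < t by rewrite ltrBlDr ltrDl.
have /rat_in_itvoo[q] : t < t + e by rewrite ltrDl.
rewrite !in_itv/= => /andP[tq qe] /andP[ep pt].
exists (p, q, b); split; first by split => //=; rewrite in_itv/= pt tq.
move=> s [Js]; rewrite /= in_itv/= => /andP[ps sq]; apply: te => //.
by rewrite /ball/= ltr_distl; lra.
Qed.

(** * Image measure and integral of the local slope *)

(** For a nonmeasurable [phi] the integral is a lower integral, a supremum over the
    simple functions below it, and so remains monotone. *)
Lemma ge0_le_integral_subset (A I : set R) (s phi : R -> \bar R) : A `<=` I ->
  (forall t, I t -> 0 <= phi t)%E -> (forall t, A t -> 0 <= s t <= phi t)%E ->
  (\int[mu]_(t in A) s t <= \int[mu]_(t in I) phi t)%E.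
Proof.
move=> AI phi0 sphi.
rewrite !ge0_integralE//; last by move=> t /sphi/andP[].
apply: ereal_sup_le => _ [u us <-]; exists u => // t.
apply: (le_trans (us t)); rewrite !patchE.
case: ifPn => [|tA]; rewrite ?inE.
  by move=> At; rewrite mem_set; [case/andP: (sphi t At)|exact: AI].
by case: ifPn => //; rewrite inE; exact: phi0.
Qed.

(** The one-dimensional theorem. The countable set [N] absorbs the times at which
    nothing is known about [h], such as the corners of a path. *)
Lemma lebesgue_measure_image_le_integral h (phi : R -> R) (I N : set R) :
  measurable I -> (mu I < +oo)%E -> countable N -> measurable_fun I h ->
  (forall t, I t -> 0 <= phi t) ->
  (forall t, I t -> ~ N t -> forall a, phi t < a -> calm_at h a I t) ->
  (mu (h @` I) <= \int[mu]_(t in I) (phi t)%:E)%E.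
Proof.
move=> mI Ioo cN mh phi0 hphi.
have mN : measurable N by exact: countable_measurable.
apply/lee_addgt0Pr => e e0.
(* Adding 1 keeps the denominator positive when [I] has measure 0. *)
pose d := e / (fine (mu I) + 1).
have muI1 : 0 < fine (mu I) + 1 by rewrite ltr_wpDl// fine_ge0.
have d0 : 0 < d by rewrite divr_gt0.
have dI : (d%:E * mu I <= e%:E)%E.
  rewrite -(fineK (x := mu I)) ?ge0_fin_numE// -EFinM lee_fin mulrAC.
  by rewrite ler_pdivrMr// ler_wpM2l ?(ltW e0)// lerDl.
clearbody d.
pose D k := (\bigcup_i cone_piece h (k.+1%:R * d) I i) `\` N.
have mD k : measurable (D k).
  apply: measurableD => //; apply: countable_bigcupT_measurable => // i.
  exact: measurable_cone_piece.
pose C := seqDU D.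
have mC k : measurable (C k) by exact: seqDU_measurable.
have tC : trivIset setT C by exact: trivIset_seqDU.
have CI k : C k `<=` I.
  by move=> t Ct; have [[i _ [[]]]] := @subset_seqDU _ D k t Ct.
have IC : I `\` N `<=` \bigcup_k C k.
  move=> t [It Nt]; rewrite -seqDU_bigcup_eq.
  pose k := Num.bound (phi t / d).
  have tk : phi t < k.+1%:R * d.
    rewrite -ltr_pdivrMr// (lt_trans (archi_boundP _)) ?ltr_nat//.
    by rewrite divr_ge0 ?phi0// ltW.
  have [i ti] := calm_at_cone_piece It (hphi t It Nt _ tk).
  by exists k => //; split => //; exists i.
(* Were [phi t] smaller, [t] would already lie in [D k.-1]. *)
have phiC k t : C k t -> k%:R * d <= phi t.
  move=> Ckt; have It := CI _ _ Ckt.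
  have [k0|k0] := posnP k; first by rewrite k0 mul0r phi0.
  rewrite leNgt; apply/negP => tk.
  case: Ckt => -[_ Nt]; apply.
  rewrite -bigcup_mkord; exists k.-1; first by rewrite /= prednK.
  rewrite -(prednK k0) in tk.
  have [i ti] := calm_at_cone_piece It (hphi t It Nt _ tk).
  by split => //; exists i.
(* The default value of [xget] only matters outside the union of the [C k]. *)
pose s t := (xget 0%N [set k | C k t])%:R * d.
have sC k t : C k t -> s t = k%:R * d.
  move=> Ckt; rewrite /s; congr (_%:R * _); apply: xget_unique => // j Cjt.
  by apply: (@trivIset_seqDU _ D) => //; exists t.
have hC k : (mu (h @` C k) <= (k.+1%:R * d)%:E * mu (C k))%E.
  apply: (@lebesgue_measure_image_bigcup _ _ _ _ (cone_piece h (k.+1%:R * d) I)) => //.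
  - by rewrite mulr_ge0// ltW.
  - by move=> i; exact: measurable_cone_piece.
  - by move=> t Ct; have [] := @subset_seqDU _ D k t Ct.
  - move=> i S' _ S'D; apply: lebesgue_measure_lipschitz_image.
      by rewrite mulr_gt0.
    by move=> x y /S'D cx /S'D cy; exact: cone_piece_lipschitz cx cy.
apply: (@le_trans _ _ (\sum_(k <oo) mu (h @` C k))%E).
  apply: (le_trans _ (lebesgue_measure_bigcup_le _)).
  have hN0 : (mu (h @` N) = 0)%E.
    by apply: countable_lebesgue_measure0; exact: sub_countable (card_image_le _ _) cN.
  rewrite -[leRHS]add0e -hN0; apply: le_trans (lebesgue_measureU_le _ _).
  apply: lebesgue_measure_subset => _ [t It <-].
  have [Nt|Nt] := pselect (N t); first by left; exists t.
  by right; have [k _ Ckt] := IC t (conj It Nt); exists k => //; exists t.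
(* Split the slope [(k + 1) d] into [k d], which [phi] dominates, and [d], which
   contributes at most [d * mu I] in total. *)
apply: (@le_trans _ _ (\sum_(k <oo) ((k%:R * d)%:E * mu (C k) + d%:E * mu (C k)))%E).
  apply: lee_nneseries => [//|k _]; rewrite (le_trans (hC k))//.
  by rewrite -natr1 mulrDl mul1r EFinD ge0_muleDl ?lee_fin ?mulr_ge0 ?ler0n ?(ltW d0).
have sd0 : (0 <= d%:E)%E by rewrite lee_fin ltW.
rewrite nneseriesD; [|by move=> k _ _; rewrite mule_ge0// lee_fin mulr_ge0// ltW|
  by move=> k _ _; rewrite mule_ge0].
apply: leeD; last first.
  rewrite nneseriesZl// -measure_semi_bigcup//; last first.
    by apply: bigcup_measurable => k _; exact: mC.
  rewrite (le_trans _ dI)// lee_wpmul2l// lebesgue_measure_subset//.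
  by apply: bigcup_sub => k _; exact: CI.
apply: (@le_trans _ _ (\int[mu]_(t in \bigcup_k C k) (s t)%:E)%E); last first.
  apply: ge0_le_integral_subset.
  - by apply: bigcup_sub => k _; exact: CI.
  - by move=> t It; rewrite lee_fin phi0.
  - move=> t [k _ Ckt]; rewrite !lee_fin (sC _ _ Ckt) (mulr_ge0 _ (ltW d0))//=.
    exact: phiC.
rewrite ge0_integral_bigcup//.
- apply: lee_nneseries => [k _ _|k _]; first by rewrite mule_ge0// lee_fin mulr_ge0// ltW.
  rewrite -(integral_cst mu (mC k)) le_eqVlt; apply/orP; left.
  apply/eqP/eq_integral => t.
  by rewrite inE => /sC /= ->.
- apply/measurable_fun_bigcup => // k.
  have : measurable_fun (C k) (cst (k%:R * d)%:E) by exact: measurable_cst.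
  by apply: eq_measurable_fun => t; rewrite inE => /sC /= ->.
- by move=> t _; rewrite lee_fin mulr_ge0// ltW.
Qed.
End AboveCone.

(** * Differentiation along a curve *)

Lemma differentiable_bounded (R : realType) (E F : normedModType R) (f : E -> F) x :
  differentiable f x -> exists K, forall v, `|'d f x v| <= K * `|v|.
Proof.
move=> df.
have /linear_boundedP : bounded_near ('d f x) (nbhs (0 : E)).
  exact/linear_bounded_continuous/diff_continuous.
by move=> [K [_ h]]; exists (K + 1); apply: h; rewrite ltrDl.
Qed.

(** The chain rule as a local Lipschitz estimate. The curve [c] is described by its
    difference quotients only, which is the form in which velocities of paths
    in a manifold are given. *)
Lemma differentiable_along_curve (R : realType) (E F : normedModType R)
    (f : E -> F) (c : R -> E) (t a : R) (w : E) :
  differentiable f (c t) ->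
  (fun s => (s - t)^-1 *: (c s - c t)) @ t^' --> w ->
  `|'d f (c t) w| < a ->
  \forall s \near t, `|f (c s) - f (c t)| <= a * `|s - t|.
Proof.
move=> df cw dwa.
pose q s := (s - t)^-1 *: (c s - c t).
have dq : `|'d f (c t) (q s)| @[s --> t^'] --> `|'d f (c t) w|.
  apply: cvg_norm; apply: (cvg_comp _ _ cw).
  exact: (diff_continuous df).
(* The gap [a - |df w|] is shared between the linear part and the remainder. *)
pose e := (a - `|'d f (c t) w|) / 2.
have e0 : 0 < e by rewrite divr_gt0// subr_gt0.
pose n := e / (`|w| + 1).
have w1 : 0 < `|w| + 1 by rewrite ltr_wpDl.
have n0 : 0 < n by rewrite divr_gt0.
have qb : \forall s \near t^', `|q s| <= `|w| + 1.
  have /cvgrPdist_le/(_ _ ltr01) : `|q s| @[s --> t^'] --> `|w| by apply: cvg_norm.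
  apply: filterS => s /=; rewrite ler_distl; lra.
have dqb : \forall s \near t^', `|'d f (c t) (q s)| <= `|'d f (c t) w| + e.
  move/cvgrPdist_le : dq => /(_ _ e0); apply: filterS => s /=; rewrite ler_distl; lra.
have cs s : s != t -> c s - c t = (s - t) *: q s.
  by move=> st; rewrite /q scalerA mulfV ?scale1r// subr_eq0.
have cc : (c s - c t) @[s --> t^'] --> (0 : E).
  have : (s - t) *: q s @[s --> t^'] --> (0 : R) *: w.
    apply: cvgZ; last exact: cw.
    apply: cvg_trans (cvg_app _ (@nbhs_dnbhs _ t)) _.
    by rewrite -[X in _ --> X](subrr t); apply: cvgB; [exact: cvg_id|exact: cvg_cst].
  rewrite scale0r; apply: cvg_trans; apply: near_eq_cvg.
  have := @nbhs_dnbhs_neq _ t.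
  by apply: filterS => s st; rewrite cs.
have fo : \forall s \near t^',
    `|f (c s) - f (c t) - 'd f (c t) (c s - c t)| <= n * `|c s - c t|.
  have /eqaddoP/(_ _ n0)/cc := diff_locally df.
  by rewrite !nbhs_simpl /=; apply: filterS => s; rewrite /= !fctE/= subrK opprD addrA.
have fa : \forall s \near t^', `|f (c s) - f (c t)| <= a * `|s - t|.
  have := @nbhs_dnbhs_neq _ t.
  apply: filter_app; apply: filter_app dqb; apply: filter_app qb.
  apply: filterS fo => s fs qs dqs st.
  rewrite -[X in `|X|](subrK ('d f (c t) (c s - c t))).
  apply: (le_trans (ler_normD _ _)).
  apply: (@le_trans _ _ (n * ((`|w| + 1) * `|s - t|) + (`|'d f (c t) w| + e) * `|s - t|)).
    apply: lerD.
      apply: (le_trans fs); rewrite ler_pM2l// cs// normrZ mulrC.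
      by rewrite ler_wpM2r.
    by rewrite cs// linearZ/= normrZ mulrC ler_wpM2r.
  rewrite mulrA divfK ?gt_eqF// -mulrDl ler_wpM2r// /e; lra.
have : \forall s \near t, s != t -> `|f (c s) - f (c t)| <= a * `|s - t| by exact: fa.
apply: filterS => s hs; have [->|] := eqVneq s t; last exact: hs.
by rewrite !subrr !normr0 mulr0.
Qed.

(** * Subdifferentials along a path in a Riemannian manifold *)

Section Riemannian.
Context {R : realType} {E : normedModType R} {M : topologicalType}.
Variable g : riemannian E M.

Lemma C1_fun_differentiable phi (i : chart_index g) p : C1_fun g phi ->
  chart_dom i p -> differentiable (phi \o chart_inv i : E -> R^o) (chart i p).
Proof. by move=> /(_ i)[+ _] ip; apply; exists p. Qed.

(** The supremum defining [conorm] is meaningful because differentials are bounded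
    in a chart and the metric is equivalent to the norm of the model space. *)
Lemma le_conorm (phi : M -> R) (p : M) (zeta : tangent g p -> R) v : C1_fun g phi ->
  is_differential phi zeta -> tnorm v = 1 -> `|zeta v| <= conorm zeta.
Proof.
move=> C1 dz v1; apply: ub_le_sup; last by exists v.
have [i ip] := chart_cover g p.
have [K hK] := differentiable_bounded (C1_fun_differentiable C1 ip).
have [c [C [c0 _ hc]]] := metric_equiv ip.
exists (`|K| / c) => _ [u /= u1 <-].
rewrite (dz i ip) (le_trans (hK _))//.
rewrite ler_pdivlMr// -mulrA.
apply: (@le_trans _ _ (`|K| * (`|u i| * c))).
  by rewrite ler_wpM2r ?ler_norm// mulr_ge0// ltW.
rewrite ler_piMr// mulrC.
by have /andP[+ _] := hc u; rewrite -/(tnorm u) u1.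
Qed.

Lemma Phi_ge0 (f : M -> R) p : 0 <= Phi g f p.
Proof.
rewrite /Phi; set S := (X in inf X).
have [->|/set0P S0] := eqVneq S set0; first by rewrite inf0.
apply: lb_le_inf => // _ [zeta _ <-]; rewrite /conorm.
set U := (X in sup X); have [supU|/sup_out->//] := pselect (has_sup U).
have [[y [v v1 vy]] bU] := supU.
by apply: (le_trans (normr_ge0 (zeta v))); apply: ub_le_sup => //; exists v.
Qed.

(** Bridge to the real line: a bound on [Phi] at an interior time with unit
    velocity gives a one-sided cone condition for [f \o gamma]. *)
Lemma Phi_lt_calm (f : M -> R) (I : set R) (gamma : R -> M) (t a : R)
    (w : tangent g (gamma t)) :
  subdiff g f (gamma t) `|` superdiff g f (gamma t) !=set0 ->
  {for t, continuous gamma} ->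
  (forall i : chart_index g, chart_dom i (gamma t) ->
    (fun s => (s - t)^-1 *: (chart i (gamma s) - chart i (gamma t))) @ t^' --> w i) ->
  tnorm w = 1 -> Phi g f (gamma t) < a ->
  calm_at (f \o gamma) a I t.
Proof.
move=> [z0 hz0] cg vel w1 Phia.
have [|_ [zeta hz <-] za] := inf_lt _ Phia; first by exists (conorm z0), z0.
have key phi : C1_fun g phi -> is_differential phi zeta ->
    \forall s \near t, `|phi (gamma s) - phi (gamma t)| <= a * `|s - t|.
  move=> C1 dz; have [i ip] := chart_cover g (gamma t).
  have := @differentiable_along_curve _ _ _ (phi \o chart_inv i : E -> R^o)
    (fun s => chart i (gamma s)) t a (w i) (C1_fun_differentiable C1 ip) (vel i ip).
  rewrite -(dz i ip w) => /(_ (le_lt_trans (le_conorm C1 dz w1) za)).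
  have : \forall s \near t, chart_dom i (gamma s).
    by apply: cg; apply: open_nbhs_nbhs; split => //; exact: chart_dom_open.
  by apply: filterS2 => s is_; rewrite /= !chartK.
case: hz => -[phi [C1 ext dz]]; [left|right]; have := cg _ ext;
  apply: filterS2 (key phi C1 dz) => s + + _; rewrite ler_norml /=; lra.
Qed.

(** Measurability is checked on open sets; the continuity of [gamma] relative to
    [I] suffices, since preimages only matter up to their trace on [I]. *)
Lemma borel_path_measurable (f : M -> R) (I : set R) (gamma : R -> M) :
  measurable I -> {within I, continuous gamma} -> borel_fun f ->
  measurable_fun I (f \o gamma).
Proof.
move=> mI cg bf _ B mB; rewrite setIC.
pose G := [set X : set M | measurable (gamma @^-1` X `&` I)].
suff : <<s @open M >> `<=` G by move/(_ _ (bf _ mB)).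
apply: smallest_sub.
  split.
  - by rewrite /G/= preimage_set0 set0I.
  - move=> X; rewrite /G /= => mX.
    rewrite (_ : _ `&` I = I `\` (gamma @^-1` X `&` I)); first exact: measurableD.
    by apply/seteqP; split => s /=; tauto.
  - move=> F mF; rewrite /G/= preimage_bigcup setI_bigcupl.
    by apply: bigcup_measurable => k _; exact: mF.
move=> U oU; rewrite /G/=.
have /open_subspaceP[V oV <-] : open (gamma @^-1` U : set (subspace I)).
  by move/continuousP : cg; exact.
by apply: measurableI => //; exact: open_measurable.
Qed.

Lemma itv_partition_piece (a b : R) (s : seq R) t : itv_partition a b s ->
  a <= t <= b -> t \notin a :: s ->
  exists k, (k < size s)%N /\ nth 0 (a :: s) k < t < nth 0 (a :: s) k.+1.
Proof.
elim: s a => [|x s IH] a.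
  move=> /itv_partition_nil <-; rewrite inE => /andP[at_ ta].
  by rewrite eq_le ta at_.
move=> ps /andP[at_ tb]; rewrite !inE !negb_or => /and3P[ta tx ts].
have [xt|tx'] := ltP t x.
  by exists 0%N; split => //=; rewrite xt lt_neqAle eq_sym ta at_.
have xtb : x <= t <= b by rewrite tx' tb.
have txs : t \notin x :: s by rewrite inE negb_or tx.
have [k [ks hk]] := IH x (itv_partition_cons ps) xtb txs.
by exists k.+1.
Qed.

End Riemannian.

Theorem theorem4p20 (R : realType) (E : completeNormedModType R)
    (dotE : {dot E for idfun}) (hilbertE : forall x : E, dotE x x = `|x| ^+ 2)
    (M : topologicalType) (g : riemannian E M)
    (f : M -> R) (borelf : borel_fun f)
    (hD : forall p : M, subdiff g f p `|` superdiff g f p !=set0)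
    (T : R) (hT : 0 < T) (gamma : R -> M)
    (path_gamma : is_path g T gamma)
    (arc_gamma : arc_length_param g T gamma) :
  (lebesgue_measure (f @` (gamma @` `[0%R, T])) <=
   \int[lebesgue_measure]_(t in `[0%R, T]) (Phi g f (gamma t))%:E)%E.
Proof.
have [cg [s [ps hs]]] := path_gamma.
rewrite image_comp.
apply: (@lebesgue_measure_image_le_integral _ (f \o gamma)
  (fun t => Phi g f (gamma t)) _ [set` 0 :: s]).
- exact: measurable_itv.
- by rewrite lebesgue_measure_itv/= lte_fin hT -EFinD ltry.
- by apply: finite_set_countable; exact: finite_seq.
- exact: borel_path_measurable.
- by move=> t _; exact: Phi_ge0.
move=> t It nt a Pa.
have [k [ks /andP[kt tk]]] := itv_partition_piece ps It (introN idP nt).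
have ks1 : (k.+1 < (size s).+1)%N by [].
have sub : `[nth 0 (0 :: s) k, nth 0 (0 :: s) k.+1]%classic `<=` `[0, T].
  move=> u; rewrite /= !in_itv/= => /andP[ku uk].
  have := itv_partition_nth_ge (ltnW ks1) ps.
  have := itv_partition_nth_le ks1 ps.
  rewrite !(set_nth_default 0 T)//; last exact: ltnW.
  by move=> k1T k0; rewrite (le_trans k0 ku) (le_trans uk k1T).
have int : (`[nth 0 (0 :: s) k, nth 0 (0 :: s) k.+1]%classic)° t.
  by rewrite interior_itv_bnd /= in_itv/= kt tk.
have int0 := interiorS sub int.
(* Velocities relative to the piece and to [[0, T]] agree at interior times. *)
have dn (J : set R) : J° t -> within J t^' = t^'.
  move=> Jt; apply/seteqP; split => X; rewrite /within /=.
    by apply: filterS2 (nbhs_dnbhs Jt) => u Ju; apply.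
  by apply: filterS.
have [w hw] := hs k ks.
have [|wt _] := hw t; first by rewrite in_itv/= !ltW.
apply: (@Phi_lt_calm _ _ _ g f `[0, T] gamma t a (w t)) => //.
- by have := cg t; rewrite /continuous_at -(nbhs_subspace_interior int0).
- by move=> i it; have := wt i it; rewrite dn.
apply: (arc_gamma t It) => i it; have := wt i it; rewrite !dn//.
Qed.
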